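(* Let $\epsilon,\kappa,\sigma>0$, $0<\theta<\theta_c$, $0<\delta<1$, and let $u^0\in\mathcal{M}_h$ have all its values in $(-1,1)$. The P-ETD1 scheme conserves mass unconditionally: for any time step size $\tau>0$, any sequence $(u^n)_{n\ge 0}$ in $\mathcal{M}_h$ generated by the P-ETD1 scheme from $u^0$ satisfies $$\langle u^{n+1},1\rangle=\langle u^n,1\rangle\qquad\text{for all } n\ge 0.$$
   Context: **Grid functions.** Let $\Omega=(0,L)\times(0,L)$, let $M$ be a positive integer, $h=L/M$, and let $\mathcal{M}_h$ be the space of real grid functions $v=(v_{ij})$ on the mesh points $(x_i,y_j)=(ih,jh)$, $1\le i,j\le M$, extended $M$-periodically in each index. Set $\langle v,w\rangle=h^2\sum_{i,j=1}^M v_{ij}w_{ij}$, $\|v\|_\infty=\max_{i,j}|v_{ij}|$ and $\overline{v}=L^{-2}\langle v,1\rangle$. The discrete Laplacian is $\Delta_h v_{ij}=h^{-2}(v_{i+1,j}+v_{i-1,j}+v_{i,j-1}+v_{i,j+1}-4v_{ij})$. Linear operators on $\mathcal{M}_h$ are identified with matrices, and functions of a symmetric operator are understood spectrally. Products, powers and inequalities of grid functions are pointwise. **Operators.** $L_h=\epsilon^2\Delta_h^2-\kappa\Delta_h+\sigma I$ (symmetric positive definite), and for $v\in\mathcal{M}_h$ with values in $(-1,1)$, $$F(v)=\tfrac{\theta}{2}\Delta_h[\ln(1+v)-\ln(1-v)]-\theta_c\Delta_h v-\kappa\Delta_h v+\sigma\overline{v}.$$ Let $\varphi_0(a)=e^{-a}$,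 $\varphi_1(a)=\frac{1-e^{-a}}{a}$. **P-ETD1 scheme.** Given $u^n$, the prediction is $$\widetilde u^{n+1}=\varphi_0(\tau L_h)u^n+\tau\varphi_1(\tau L_h)F(u^n)=e^{-\tau L_h}u^n+\int_0^\tau e^{-(\tau-s)L_h}F(u^n)\,ds.$$ The correction $u^{n+1}$ is the minimizer of $\frac12\langle\phi-\widetilde u^{n+1},\phi-\widetilde u^{n+1}\rangle$ over all $\phi\in\mathcal{M}_h$ with $\|\phi\|_\infty\le 1-\delta$ and $\langle\phi,1\rangle=\langle\widetilde u^{n+1},1\rangle$. This is characterized by the Karush-Kuhn-Tucker system: with $g(u)=(1-\delta)^2-u^2$, there are $\lambda_h^{n+1}\in\mathcal{M}_h$ and $\xi_h^{n+1}\in\mathbb{R}$ such that $$u^{n+1}=\widetilde u^{n+1}+\lambda_h^{n+1}g'(u^{n+1})+\xi_h^{n+1},$$ $$\lambda_h^{n+1}g(u^{n+1})=0,\quad \lambda_h^{n+1}\ge0,\quad g(u^{n+1})\ge0,$$ $$\langle u^{n+1},1\rangle=\langle\widetilde u^{n+1},1\rangle.$$ *)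

(* Defs.v *)
From HB Require Import structures.
From mathcomp Require Import all_boot all_order all_algebra.
From mathcomp Require Import spectral.
From mathcomp Require Import complex.
From mathcomp Require Import all_classical all_reals all_analysis.

Set Implicit Arguments.
Unset Strict Implicit.
Unset Printing Implicit Defensive.

Import Order.TTheory GRing.Theory Num.Theory.
Import numFieldNormedType.Exports.

Local Open Scope ring_scope.

(* A grid function is a matrix v : 'M[R]_M, whose entry v i j, with i, j in
   {0, ..., M-1}, stands for the value at the mesh point ((i+1)h, (j+1)h).
   The M-periodic extension is built into the cyclic shifts ordS and ord_pred
   of 'I_M. *)

Section Grid.
Variables (R : realType) (M : nat) (L : R).
Implicit Types v w : 'M[R]_M.

Definition mesh : R := L / M%:R.

Definition grid_inner v w : R :=
  mesh ^+ 2 * \sum_(i < M) \sum_(j < M) v i j * w i j.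

Definition grid_mean v : R := (L ^+ 2)^-1 * grid_inner v (const_mx 1).

Definition dlaplace v : 'M[R]_M :=
  \matrix_(i, j) ((mesh ^+ 2)^-1 *
    (v (ordS i) j + v (ord_pred i) j + v i (ord_pred j) + v i (ordS j)
     - 4 * v i j)).

End Grid.

(* f(A) = P^-1 f(D) P for a real symmetric A, where A = P^-1 D P is a unitary
   diagonalization over R[i]. D is real because A is symmetric, and the result
   is real and does not depend on the diagonalization; spectralmx and
   spectral_diag are the one chosen by the library. The value is meaningless
   when A is not symmetric. *)
Definition mxfun (R : realType) (n : nat) (f : R -> R) (A : 'M[R]_n) :
    'M[R]_n :=
  let cA := map_mx (real_complex R) A in
  let P := spectralmx cA in
  let fD := diag_mx
    (map_mx (fun z => real_complex R (f (complex.Re z))) (spectral_diag cA)) in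
  map_mx (@complex.Re R) (invmx P *m fD *m P).

(* A linear operator T on grid functions is identified with its matrix lin_mx T,
   which acts on the right of the row vector mxvec v; opfun f c T is the
   operator f(c T). *)
Definition opfun (R : realType) (M : nat) (f : R -> R) (c : R)
    (T : 'M[R]_M -> 'M[R]_M) (v : 'M[R]_M) : 'M[R]_M :=
  vec_mx (mxvec v *m mxfun f (c *: lin_mx T)).

Definition phi0 (R : realType) (a : R) : R := expR (- a).

(* Only used at a > 0, so the value at a = 0 is irrelevant. *)
Definition phi1 (R : realType) (a : R) : R := (1 - expR (- a)) / a.

Section Scheme.
Variables (R : realType) (M : nat).
Variables (L epsilon kappa sigma theta theta_c delta tau : R).
Implicit Types u v phi : 'M[R]_M.

Definition Lh v : 'M[R]_M :=
  epsilon ^+ 2 *: dlaplace L (dlaplace L v) - kappa *: dlaplace L v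
  + sigma *: v.

Definition Fh v : 'M[R]_M :=
  (theta / 2) *: dlaplace L (map_mx (fun x => ln (1 + x) - ln (1 - x)) v)
  - theta_c *: dlaplace L v - kappa *: dlaplace L v
  + const_mx (sigma * grid_mean L v).

Definition etd1_predict u : 'M[R]_M :=
  opfun (@phi0 R) tau Lh u + tau *: opfun (@phi1 R) tau Lh (Fh u).

Definition admissible v phi : Prop :=
  mx_norm phi <= 1 - delta
  /\ grid_inner L phi (const_mx 1) = grid_inner L v (const_mx 1).

(* u is a minimizer, necessarily unique by strict convexity, of the squared
   distance to v over the admissible set. *)
Definition is_correction v u : Prop :=
  admissible v u
  /\ forall phi, admissible v phi ->
       2^-1 * grid_inner L (u - v) (u - v)
       <= 2^-1 * grid_inner L (phi - v) (phi - v).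

Definition petd1_generated (u0 : 'M[R]_M) (u : nat -> 'M[R]_M) : Prop :=
  u 0%N = u0 /\ forall n, is_correction (etd1_predict (u n)) (u n.+1).

End Scheme.

(* Main.v *)
Require Import Defs.
From mathcomp Require Import all_boot all_order all_algebra.
From mathcomp Require Import spectral complex.
From mathcomp Require Import ring.
From mathcomp Require Import all_classical all_reals all_analysis.

Import Order.TTheory GRing.Theory Num.Theory.
Local Open Scope ring_scope.

(* Constants are eigenvectors of the symmetric operator L_h with eigenvalue
   sigma, hence of f(tau L_h) with eigenvalue f(tau sigma), and F(u) has mass
   sigma <u, 1> because the discrete Laplacian is symmetric and annihilates
   constants. The prediction therefore has mass
   (phi_0(tau sigma) + tau sigma phi_1(tau sigma)) <u, 1> = <u, 1>, and the
   correction preserves the mass of the prediction. *)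

(** In the coordinates given by the unitary [P], [A] is diagonal, so each coordinate of [P x] either
    vanishes or sits at a spectral entry equal to [a]. Hence [f] of the diagonal acts on [P x] as
    the scalar [f a]. *)
Lemma mxfun_eigen_col (R : realType) (n : nat) (f : R -> R) (A : 'M[R]_n)
    (x : 'cV[R]_n) (a : R) :
  A^T = A -> A *m x = a *: x -> mxfun f A *m x = f a *: x.
Proof.
move=> symA Ax; rewrite /mxfun.
set cA := map_mx _ A; set P := spectralmx cA; set sp := spectral_diag cA.
have normalA : cA \is normalmx.
  apply/normalmxP; suff -> : (cA ^t* )%sesqui = cA by [].
  by apply/matrixP=> i j; rewrite !mxE -[in RHS]symA mxE; apply: conjc_real.
have cAE := orthomx_spectralP normalA.
have unitP : P \in unitmx by rewrite unitarymx_unit ?spectral_unitarymx.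
set cx := map_mx (real_complex R) x.
have cAx : cA *m cx = real_complex R a *: cx.
  by rewrite -map_mxM Ax map_mxZ.
have spPx i : sp 0 i * (P *m cx) i 0 = real_complex R a * (P *m cx) i 0.
  have: P *m (cA *m cx) = P *m (real_complex R a *: cx) by rewrite cAx.
  rewrite {1}cAE !mulmxA mulmxV // mul1mx -mulmxA -/sp mul_diag_mx -scalemxAr.
  by move/matrixP/(_ i 0); rewrite !mxE.
set B := invmx P *m _ *m P.
have Bx : B *m cx = real_complex R (f a) *: cx.
  rewrite /B -!mulmxA -[in RHS](mulKmx unitP cx) [in RHS]scalemxAr.
  congr (_ *m _); apply/colP=> i; rewrite mul_diag_mx !mxE.
  have := spPx i; rewrite !mxE; set y := \sum_j _.
  have [-> | y0] := eqVneq y 0; first by rewrite !mulr0.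
  by move/(mulIf y0) ->.
(* [B] need not be shown to be real: since [x] is real, taking entrywise real parts commutes with
   multiplication by [x]. *)
have ReM (z : complex.complex R) (r : R) :
    complex.Re (z * real_complex R r) = complex.Re z * r.
  by case: z => p q /=; rewrite mulr0 subr0.
apply/colP=> i; have /colP/(_ i) := Bx.
rewrite !mxE => /(congr1 (@complex.Re R)).
rewrite raddf_sum /= mulr0 subr0 => <-.
by apply: eq_bigr => j _; rewrite !mxE ReM.
Qed.

Section GridInner.
Variables (R : realType) (M : nat) (L : R).
Implicit Types (v w : 'M[R]_M) (T : 'M[R]_M -> 'M[R]_M).

Lemma grid_inner_trace v w :
  grid_inner L v w = mesh M L ^+ 2 * \tr (v *m w^T).
Proof.
congr (_ * _); apply: eq_bigr => i _; rewrite mxE.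
by apply: eq_bigr => j _; rewrite mxE.
Qed.

Lemma grid_inner_mxvec v w :
  grid_inner L v w = mesh M L ^+ 2 * (mxvec v *m (mxvec w)^T) 0 0.
Proof.
congr (_ * _); rewrite pair_bigA /= mxE (reindex _ (curry_mxvec_bij M M)) /=.
by apply: eq_bigr => -[i j] _; rewrite mxE !mxvecE.
Qed.

Lemma grid_innerC v w : grid_inner L v w = grid_inner L w v.
Proof. by rewrite !grid_inner_trace -mxtrace_tr trmx_mul trmxK. Qed.

Lemma grid_innerDl v1 v2 w :
  grid_inner L (v1 + v2) w = grid_inner L v1 w + grid_inner L v2 w.
Proof. by rewrite !grid_inner_trace mulmxDl linearD mulrDr. Qed.

Lemma grid_innerZl a v w : grid_inner L (a *: v) w = a * grid_inner L v w.
Proof. by rewrite !grid_inner_trace -scalemxAl linearZ /= mulrCA. Qed.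

Lemma grid_innerNl v w : grid_inner L (- v) w = - grid_inner L v w.
Proof. by rewrite -scaleN1r grid_innerZl mulN1r. Qed.

Lemma grid_innerDr v w1 w2 :
  grid_inner L v (w1 + w2) = grid_inner L v w1 + grid_inner L v w2.
Proof. by rewrite grid_innerC grid_innerDl ![grid_inner _ _ v]grid_innerC. Qed.

Lemma grid_innerZr a v w : grid_inner L v (a *: w) = a * grid_inner L v w.
Proof. by rewrite grid_innerC grid_innerZl grid_innerC. Qed.

Lemma grid_innerNr v w : grid_inner L v (- w) = - grid_inner L v w.
Proof. by rewrite grid_innerC grid_innerNl grid_innerC. Qed.

Definition grid_innerE :=
  (grid_innerDl, grid_innerDr, grid_innerNl, grid_innerNr,
   grid_innerZl, grid_innerZr).

(** Summation by parts in its periodic form: reindexing both sums shows that the adjoint of a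
    permutation of the mesh points is the inverse permutation. *)
Lemma grid_inner_mxsub (f f' g g' : 'I_M -> 'I_M) v w :
  cancel f f' -> cancel f' f -> cancel g g' -> cancel g' g ->
  grid_inner L (mxsub f g v) w = grid_inner L v (mxsub f' g' w).
Proof.
move=> fK f'K gK g'K; congr (_ * _).
have bij_f' : bijective f' by exists f.
have bij_g' : bijective g' by exists g.
rewrite [LHS](reindex f' (onW_bij _ bij_f')) /=; apply: eq_bigr => i _.
rewrite [LHS](reindex g' (onW_bij _ bij_g')) /=; apply: eq_bigr => j _.
by rewrite !mxE f'K g'K.
Qed.

Lemma dlaplace_mxsub v :
  dlaplace L v = (mesh M L ^+ 2)^-1 *:
    (mxsub (@ordS M) id v + mxsub (@ord_pred M) id v
     + mxsub id (@ord_pred M) v + mxsub id (@ordS M) v - 4 *: v).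
Proof. by apply/matrixP=> i j; rewrite !mxE. Qed.

(** Taking adjoints swaps the forward and backward shifts in each direction, and the stencil gives
    both the same weight. *)
Lemma dlaplace_selfadjoint v w :
  grid_inner L (dlaplace L v) w = grid_inner L v (dlaplace L w).
Proof.
rewrite !dlaplace_mxsub !grid_innerE.
have SK := @ordSK M; have PK := @ord_predK M.
rewrite (grid_inner_mxsub _ _ _ _ v w SK PK (frefl id) (frefl id)).
rewrite (grid_inner_mxsub _ _ _ _ v w PK SK (frefl id) (frefl id)).
rewrite (grid_inner_mxsub _ _ _ _ v w (frefl id) (frefl id) SK PK).
rewrite (grid_inner_mxsub _ _ _ _ v w (frefl id) (frefl id) PK SK).
by ring.
Qed.

Lemma dlaplace_const c : dlaplace L (const_mx c) = 0 :> 'M[R]_M.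
Proof. by apply/matrixP=> i j; rewrite !mxE; ring. Qed.

Lemma grid_inner_dlaplace_const v c :
  grid_inner L (dlaplace L v) (const_mx c) = 0.
Proof.
by rewrite dlaplace_selfadjoint dlaplace_const -(scale0r 0) grid_innerZr mul0r.
Qed.

Hypotheses (hM : (0 < M)%N) (hL : 0 < L).

Lemma mesh_sqr_neq0 : mesh M L ^+ 2 != 0.
Proof. by rewrite expf_neq0 // gt_eqF // divr_gt0 // ltr0n. Qed.

Lemma grid_inner_const_mean v :
  grid_inner L (const_mx (grid_mean L v)) (const_mx 1 : 'M[R]_M) =
  grid_inner L v (const_mx 1).
Proof.
have -> c : grid_inner L (const_mx c) (const_mx 1 : 'M[R]_M) = L ^+ 2 * c.
  rewrite /grid_inner (eq_bigr (fun=> M%:R * c)) => [|i _]; last first.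
    rewrite (eq_bigr (fun=> c)) => [|j _]; last by rewrite !mxE mulr1.
    by rewrite sumr_const card_ord mulr_natl.
  (* The [M * M] mesh points each contribute [h^2 c], and [M h = L]. *)
  rewrite sumr_const card_ord -mulr_natl /mesh.
  by field; rewrite pnatr_eq0 -lt0n.
by rewrite /grid_mean mulVKf // expf_neq0 // gt_eqF.
Qed.

(** Bridge between grid functions and matrices: through it, self-adjointness for [grid_inner]
    becomes symmetry of [lin_mx T]. *)
Lemma lin_mxE T i j :
  mesh M L ^+ 2 * lin_mx T i j =
  grid_inner L (T (vec_mx (delta_mx 0 i))) (vec_mx (delta_mx 0 j)).
Proof.
rewrite grid_inner_mxvec vec_mxK trmx_delta -colE [in RHS]mxE.
by rewrite /lin_mx [in LHS]mxE.
Qed.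

Lemma lin_mx_sym T :
  (forall v w, grid_inner L (T v) w = grid_inner L v (T w)) ->
  (lin_mx T)^T = lin_mx T.
Proof.
move=> adjT; apply/matrixP=> i j; apply: (mulfI mesh_sqr_neq0).
by rewrite mxE !lin_mxE adjT grid_innerC.
Qed.

(** The hypothesis makes [w] an eigenvector of the adjoint of [T]. As [lin_mx T] acts on the right
    of row vectors, this is a column eigenvector equation, obtained by testing on the basis grid
    functions. *)
Lemma lin_mx_eigen_col T w a :
  (forall v, grid_inner L (T v) w = a * grid_inner L v w) ->
  lin_mx T *m (mxvec w)^T = a *: (mxvec w)^T.
Proof.
move=> Tw; apply/colP=> i; apply: (mulfI mesh_sqr_neq0).
have := Tw (vec_mx (delta_mx 0 i)).
rewrite !grid_inner_mxvec vec_mxK -rowE !mxE mulrCA => <-.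
by congr (_ * _); apply: eq_bigr => j _; rewrite !mxE.
Qed.

Lemma grid_inner_opfun (f : R -> R) c T v w a :
  (forall v1 v2, grid_inner L (T v1) v2 = grid_inner L v1 (T v2)) ->
  (forall v1, grid_inner L (T v1) w = a * grid_inner L v1 w) ->
  grid_inner L (opfun f c T v) w = f (c * a) * grid_inner L v w.
Proof.
move=> adjT Tw; rewrite !grid_inner_mxvec /opfun vec_mxK -mulmxA.
rewrite (mxfun_eigen_col _ _ _ _ _ (c * a)).
- by rewrite -scalemxAr [in LHS]mxE mulrCA.
- by rewrite linearZ /= lin_mx_sym.
- by rewrite -scalemxAl (lin_mx_eigen_col _ _ a) ?scalerA.
Qed.

Variables epsilon kappa sigma theta theta_c tau : R.

Lemma Lh_selfadjoint v w :
  grid_inner L (Lh L epsilon kappa sigma v) w =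
  grid_inner L v (Lh L epsilon kappa sigma w).
Proof. by rewrite !grid_innerE !dlaplace_selfadjoint. Qed.

Lemma grid_inner_Lh_const v :
  grid_inner L (Lh L epsilon kappa sigma v) (const_mx 1) =
  sigma * grid_inner L v (const_mx 1).
Proof. by rewrite !grid_innerE !grid_inner_dlaplace_const; ring. Qed.

Lemma grid_inner_Fh_const v :
  grid_inner L (Fh L kappa sigma theta theta_c v) (const_mx 1) =
  sigma * grid_inner L v (const_mx 1).
Proof.
(* The factor [sigma] is pulled out of the constant grid function so that bilinearity and the mass
   of the mean apply. *)
have -> : Fh L kappa sigma theta theta_c v =
    (theta / 2) *: dlaplace L (map_mx (fun x => ln (1 + x) - ln (1 - x)) v)
    - theta_c *: dlaplace L v - kappa *: dlaplace L v
    + sigma *: const_mx (grid_mean L v) by rewrite scalemx_const.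
by rewrite !grid_innerE !grid_inner_dlaplace_const grid_inner_const_mean; ring.
Qed.

Lemma grid_inner_etd1_predict v :
  0 < sigma -> 0 < tau ->
  grid_inner L (etd1_predict L epsilon kappa sigma theta theta_c tau v)
    (const_mx 1) = grid_inner L v (const_mx 1).
Proof.
move=> hsigma htau.
have opfun_mass f w : grid_inner L (opfun f tau (Lh L epsilon kappa sigma) w)
    (const_mx 1) = f (tau * sigma) * grid_inner L w (const_mx 1).
  apply: grid_inner_opfun; first exact: Lh_selfadjoint.
  exact: grid_inner_Lh_const.
rewrite /etd1_predict grid_innerDl grid_innerZl.
(* A rewrite would also try to unify opfun phi0 with opfun phi1 by unfolding
   the spectral decomposition. *)
apply: etrans (congr2 +%R (opfun_mass _ _)
  (congr1 ( *%R tau) (opfun_mass _ _))) _.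
rewrite grid_inner_Fh_const /phi0 /phi1.
(* As [tau * sigma] is nonzero, it cancels the denominator of [phi1], and the factor of the mass is
   [e^(- tau sigma) + (1 - e^(- tau sigma)) = 1]. *)
by field; rewrite !gt_eqF.
Qed.

End GridInner.

Theorem lemma3p1 (R : realType) (M : nat) (L : R)
    (epsilon kappa sigma theta theta_c delta : R) (u0 : 'M[R]_M)
    (hM : (0 < M)%N) (hL : 0 < L)
    (hepsilon : 0 < epsilon) (hkappa : 0 < kappa) (hsigma : 0 < sigma)
    (htheta : 0 < theta) (htheta_c : theta < theta_c)
    (hdelta0 : 0 < delta) (hdelta1 : delta < 1)
    (hu0 : forall i j, -1 < u0 i j < 1) :
  forall tau : R, 0 < tau ->
  forall u : nat -> 'M[R]_M,
    petd1_generated L epsilon kappa sigma theta theta_c delta tau u0 u ->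
  forall n : nat,
    grid_inner L (u n.+1) (const_mx 1) = grid_inner L (u n) (const_mx 1).
Proof.
move=> tau htau u [_ corr] n; have [[_ ->] _] := corr n.
exact: grid_inner_etd1_predict.
Qed.
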